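(* Let $S$ be a cancellative commutative feebly compact topological monoid with open shifts satisfying the first axiom of countability. Then $S$ has countable cellularity.
   Context: No separation axiom is assumed. A topological monoid is a monoid $S$ with a topology such that the operation $S\times S\to S$ is jointly continuous. It has open shifts if for every $a\in S$ and every open $U\subseteq S$ the sets $aU$ and $Ua$ are open in $S$. A space is feebly compact if each locally finite family of open sets in it is finite. A cellular family in a space $X$ is a nonempty pairwise disjoint family of nonempty open sets in $X$; the cellularity is $c(X)=\sup\{|\mathcal U|:\mathcal U\text{ is a cellular family in }X\}+\aleph_0$, and $X$ has countable cellularity if $c(X)=\aleph_0$. *)

(* Defs.v *)
From mathcomp Require Import all_boot all_algebra.
From mathcomp Require Import all_classical topology tvs.

Set Implicit Arguments.
Unset Strict Implicit.
Unset Printing Implicit Defensive.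

Local Open Scope classical_set_scope.
Local Open Scope ring_scope.
Local Open Scope card_scope.

(* A commutative topological monoid is a [TopologicalNmodule.type]: a
   commutative monoid, written additively, with jointly continuous addition.
   Thus the shifts aU and Ua are the sets a + U and U + a. *)

Definition cancellative (S : nmodType) : Prop :=
  (forall a : S, injective (fun x : S => a + x)) /\
  (forall a : S, injective (fun x : S => x + a)).

Definition open_shifts (S : TopologicalNmodule.type) : Prop :=
  forall (a : S) (U : set S), open U ->
    open [set a + x | x in U] /\ open [set x + a | x in U].

Definition locally_finite (X : topologicalType) (F : set (set X)) : Prop :=
  forall x : X, exists2 V : set X, nbhs x V &
    finite_set [set U | F U /\ U `&` V !=set0].

Definition feebly_compact (X : topologicalType) : Prop :=
  forall F : set (set X), F `<=` open -> locally_finite F -> finite_set F.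

Definition first_countable (X : topologicalType) : Prop :=
  forall x : X, exists2 B : set (set X), countable B & nbhs x = filter_from B id.

Definition cellular (X : topologicalType) (F : set (set X)) : Prop :=
  [/\ F !=set0, trivIset F id & forall U, F U -> open U /\ U !=set0].

(* Cardinals are represented by types, up to equipotence. *)
Definition is_card_sup (T : Type) (C : set (set T)) (K : Type) : Prop :=
  (forall A, C A -> A #<= [set: K]) /\
  (forall L : Type, (forall A, C A -> A #<= [set: L]) -> [set: K] #<= [set: L]).

(* [has_cellularity X K] means c(X) = |K|; the disjoint sum with [nat] is the
   cardinal sum with aleph_0. *)
Definition has_cellularity (X : topologicalType) (K : Type) : Prop :=
  exists2 M : Type, is_card_sup (@cellular X) M & [set: K] #= [set: (M + nat)%type].

Definition countable_cellularity (X : topologicalType) : Prop :=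
  has_cellularity X nat.

(* Main.v *)
Require Import Defs.
From mathcomp Require Import all_boot all_algebra.
From mathcomp Require Import all_classical topology tvs.

(** Let [F] be a cellular family in [S]. Every member of [F] contains a
    translate [x + B] with [B] taken from a fixed countable base of
    neighbourhoods of 0, so [F] is the union, over the countably many [B], of
    the subfamilies [F_B] of the members containing a translate of [B]; it
    suffices that each [F_B] is finite ([finite_disjoint_translates]).

    Choose an open neighbourhood [W] of 0 with [W + W] contained in [B], and for
    [U] in [F_B] a point [x_U] with [x_U + B] contained in [U]. The open sets
    [x_U + W] are nonempty and pairwise disjoint. They form a locally finite
    family: the neighbourhood [y + W] of [y] meets at most one of them, for if
    [x + a = y + b] and [x' + c = y + d] with [a, b, c, d] in [W], then
    [x + (a + d) = y + b + d = x' + (c + b)] is a common point of [x + B] and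
    [x' + B]. Commutativity, used in this exchange of [b] and [d], replaces the
    symmetry [W = - W] that one would require of [W] in a topological group.
    Feeble compactness makes the family finite, and since [x_U + W] determines
    [U], so is [F_B].

    Thus all cellular families are countable, and a family of countable sets has
    a cardinal supremum that is itself countable ([countable_card_sup]); adding
    aleph_0 to it gives aleph_0. *)

Import GRing.Theory.

Local Open Scope classical_set_scope.
Local Open Scope ring_scope.
Local Open Scope card_scope.

Lemma nbhs0_addW (S : TopologicalNmodule.type) (V : set S) : nbhs (0 : S) V ->
  exists W : set S, [/\ open W, W 0 & forall a b, W a -> W b -> V (a + b)].
Proof.
move=> V0.
have : nbhs ((0, 0) : S * S) ((fun p : S * S => p.1 + p.2) @^-1` V).
  by apply: (@add_continuous S (0, 0)); rewrite /= addr0.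
case=> -[A B] /= [A0 B0] ABV.
exists (A° `&` B°); split.
- by apply: openI; exact: open_interior.
- by split.
- move=> a b [/interior_subset Aa _] [_ /interior_subset Bb].
  exact: (ABV (a, b)).
Qed.

Lemma nbhs_shift (S : TopologicalNmodule.type) (x : S) (U : set S) :
  nbhs x U -> nbhs (0 : S) ((fun v => x + v) @^-1` U).
Proof.
move=> Ux.
have : nbhs ((x, 0) : S * S) ((fun p : S * S => p.1 + p.2) @^-1` U).
  by apply: (@add_continuous S (x, 0)); rewrite /= addr0.
case=> -[A B] /= [Ax B0] ABU.
apply: filterS B0 => v Bv /=; apply: (ABU (x, v)); split=> //=.
exact: nbhs_singleton.
Qed.

(** This is where feeble compactness acts: shrinking the translates of [V] to
    translates of some [W] with [W + W] inside [V] turns a disjoint family into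
    a locally finite one. *)
Lemma finite_disjoint_translates (S : TopologicalNmodule.type)
    (V : set S) (F : set (set S)) :
  feebly_compact S -> open_shifts S -> nbhs (0 : S) V -> trivIset F id ->
  (forall U, F U -> exists x, forall v, V v -> U (x + v)) ->
  finite_set F.
Proof.
move=> fcS osS V0 tF FV.
have [W [oW W0 WWV]] := nbhs0_addW _ _ V0.
have /choice[x xP] : forall U : set S,
    exists x, F U -> forall v, V v -> U (x + v).
  move=> U; have [FU|nFU] := pselect (F U); last by exists 0.
  by have [x xU] := FV _ FU; exists x.
pose G (U : set S) := [set x U + w | w in W].
have GF (U : set S) (z : S) : F U -> G U z -> forall w, W w -> U (z + w).
  move=> FU [a Wa <-] w Ww; rewrite -addrA; apply: xP => //; exact: WWV.
have Ginj : {in F &, injective G}.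
  move=> U1 U2 /set_mem F1 /set_mem F2 G12; apply: (tF U1 U2 F1 F2).
  have G1 : G U1 (x U1) by exists 0; rewrite ?addr0.
  exists (x U1 + 0); split; first exact: GF.
  by apply: GF => //; rewrite -G12.
rewrite -(eq_finite_set (inj_card_eq Ginj)).
apply: fcS => [_ [U FU <-]|y]; first by have [] := osS (x U) W oW.
exists [set y + w | w in W].
  apply: open_nbhs_nbhs; split; first by have [] := osS y W oW.
  by exists 0; rewrite ?addr0.
set M := [set _ | _].
have [->|/set0P[G0 MG0]] := eqVneq M set0; first exact: finite_set0.
apply: (sub_finite_set _ (finite_set1 G0)) => G1.
case: MG0 => -[U FU <-] [_ [[a Wa <-] [b Wb yb]]].
case=> -[U' FU' <-] [_ [[c Wc <-] [d Wd yd]]] /=.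
congr G; apply: tF => //; exists (x U' + (c + b)); split.
  by apply: xP => //; exact: WWV.
(* x' + c + b = y + d + b = x + a + d *)
have -> : x U' + (c + b) = x U + (a + d) by rewrite !addrA -yd -yb addrAC.
by apply: xP => //; exact: WWV.
Qed.

(** The supremum is the least natural number that bounds all the cardinals, if
    there is one. Otherwise no finite type bounds them, so every upper bound is
    infinite, and [nat], an upper bound by hypothesis, is the least one. *)
Lemma countable_card_sup (T : Type) (C : set (set T)) :
  (forall A, C A -> countable A) -> exists M : countType, is_card_sup C M.
Proof.
move=> Ccount.
pose bound n := `[< forall A, C A -> A #<= [set: 'I_n] >].
have [exn|noI] := pselect (exists n, bound n).
  case: (ex_minnP exn) => n /asboolP nP nmin.
  exists 'I_n; split=> // L LP.
  have [/finite_setP[m Lm]|/infiniteP] := pselect (finite_set [set: L]); last first.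
    by apply: card_le_trans; exact: countableP.
  have Lm' : [set: L] #= [set: 'I_m] by exact: card_eq_trans Lm card_II.
  rewrite (card_le_eqr Lm') -(card_le_eql card_II) -(card_le_eqr card_II).
  rewrite card_le_II; apply: nmin; apply/asboolP => A CA.
  by rewrite -(card_le_eqr Lm'); exact: LP.
exists nat; split=> // L LP; apply/infiniteP => /finite_setP[m Lm]; apply: noI.
exists m; apply/asboolP => A CA.
by rewrite -(card_le_eqr card_II) -(card_le_eqr Lm); exact: LP.
Qed.

Lemma card_add_nat (M : countType) : [set: nat] #= [set: (M + nat)%type].
Proof.
apply: card_esym; apply: eq_card_nat; first exact: countableP.
apply/infiniteP.
have inj : {in [set: nat] &, injective (@inr M nat)} by move=> i j _ _ [].
rewrite -(card_le_eql (inj_card_eq inj)); exact: card_leT.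
Qed.

Theorem corollary4p4 (S : TopologicalNmodule.type) :
  cancellative S ->
  feebly_compact S ->
  open_shifts S ->
  first_countable S ->
  countable_cellularity S.
Proof.
move=> _ fcS osS fS.
have cellS (F : set (set S)) : cellular F -> countable F.
  case=> _ tF oF; have [B cB B0] := fS (0 : S).
  pose FB (V : set S) := [set U | F U /\ exists x, forall v, V v -> U (x + v)].
  apply: (@sub_countable _ _ _ (\bigcup_(V in B) FB V)).
    apply: subset_card_le => U FU.
    have [oU [x Ux]] := oF _ FU.
    have := nbhs_shift S x U (open_nbhs_nbhs (conj oU Ux)).
    by rewrite B0 => -[V BV VU]; exists V => //; split=> //; exists x.
  apply: bigcup_countable => // V BV; apply: finite_set_countable.
  apply: (finite_disjoint_translates S V) => // [||U []//].
    by rewrite B0; exists V.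
  by apply: sub_trivIset tF => U [].
have [M supM] := countable_card_sup _ _ cellS.
by exists M => //; exact: card_add_nat.
Qed.
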